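(* Let $m$ be a non-negative integer with $m\notin\{0,1,3,6,9,12\}$, let $r_0=\lfloor\frac{m}{3}\rfloor+1$, and let $k=3r_0-m\in\{1,2,3\}$. Then \[ \frac{1}{2^{\lfloor \frac{m}{3}\rfloor}}\left(1-\frac{k+2}{2(r_0+1)}\right)\binom{m}{r_0}< f_m(r_0) < \frac{1}{2^{\lfloor \frac{m}{3}\rfloor}}\binom{m}{r_0}. \] Furthermore, \[ f_m(r_0)<\frac{3}{\sqrt{\pi m}}\left(\frac{3}{2}\right)^{m} \qquad\text{and}\qquad \lim_{m\to\infty} f_m(r_0)\sqrt{m}\left(\frac{2}{3}\right)^{m}=\frac{3}{\sqrt{\pi}}, \] where in the limit $r_0=\lfloor\frac{m}{3}\rfloor+1$ depends on $m$.
   Context: For integers $m\ge 0$ and $r\ge 0$, $f_m(r)=2^{-r}\sum_{i=0}^r\binom{m}{i}$. *)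

(* Defs.v *)
(* MathComp-Analysis, over an arbitrary realType. *)
From mathcomp Require Import all_boot all_order all_algebra.
From mathcomp Require Import all_classical all_reals all_analysis.
Import Order.TTheory GRing.Theory Num.Theory.

Set Implicit Arguments.
Unset Strict Implicit.
Unset Printing Implicit Defensive.

Local Open Scope ring_scope.

(* The sum includes the index i = r. *)
Definition fm (R : realType) (m r : nat) : R :=
  2 ^- r * \sum_(0 <= i < r.+1) 'C(m, i)%:R.

Definition r0 (m : nat) : nat := (m %/ 3 + 1)%N.

(* Main.v *)
Require Import Defs.
From mathcomp Require Import all_boot all_order all_algebra.
From mathcomp Require Import all_classical all_reals all_analysis.
From mathcomp Require Import zify ring lra.
Import Order.TTheory GRing.Theory Num.Theory.
Import numFieldNormedType.Exports.

Local Open Scope classical_set_scope.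
Local Open Scope ring_scope.

(** Write [m = 3 p + j] with [j <= 2] and [r = p + 1], and let [S (m, r)] be the
    sum of the [binomial (m, i)] for [i <= r]. By Pascal's rule,
    [S (m + 3, r + 1)] is [8 S (m, r)] plus a combination of binomials, and it
    follows that the two gaps [2 binomial (m, r) - S (m, r)] and
    [S (m, r) - binomial (m, r + 1)] (the latter is the lower bound in disguise)
    get multiplied by less than [8] when [(m, r)] becomes [(m + 3, r + 1)]. Since
    they are [O ((27 / 4) ^ p)], such gaps cannot be nonpositive; this leaves
    [m = 2] and [m = 15], which are computed. The term
    [2 ^ - p * binomial (m, r) * (2 / 3) ^ m * sqrt m] does not decrease when [m]
    becomes [m + 3], and its limit [3 / sqrt pi] is given by Stirling's formula,
    whose constant comes from Wallis' integrals. *)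

(** * Tails of binomial sums *)

Definition binsum (m r : nat) : nat := (\sum_(0 <= i < r.+1) 'C(m, i))%N.

Lemma binsum_succ m r : binsum m r.+1 = (binsum m r + 'C(m, r.+1))%N.
Proof. by rewrite /binsum big_nat_recr. Qed.

(** Summing Pascal's rule counts each binomial of row [m] twice, except the last one, which is
    counted once. *)
Lemma binsum_double m r : (binsum m.+1 r + 'C(m, r) = 2 * binsum m r)%N.
Proof.
elim: r => [|r IHr]; first by rewrite /binsum !big_nat1 !bin0.
by rewrite !binsum_succ binS; lia.
Qed.

Lemma binsum_step m r :
  (binsum m.+3 r.+2 + 4 * 'C(m, r.+1) + 'C(m, r)
   = 8 * binsum m r.+1 + 'C(m, r.+2))%N.
Proof.
have := binsum_double m r.+1; have := binsum_double m r.+2.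
have := binsum_double m.+1 r.+2; have := binsum_double m.+2 r.+2.
by rewrite !binsum_succ !binS; lia.
Qed.

Lemma binsumSS m r : binsum m.+1 r.+1 = (binsum m r.+1 + binsum m r)%N.
Proof.
by have := binsum_double m r.+1; have := binsum_succ m r; lia.
Qed.

Lemma binsum0n r : binsum 0 r = 1%N.
Proof. by elim: r => [|r IHr]; rewrite ?binsum_succ ?IHr // /binsum big_nat1. Qed.

Lemma binsumn0 m : binsum m 0 = 1%N.
Proof. by rewrite /binsum big_nat1 bin0. Qed.

(** * Positivity of the two gaps *)

Section real_inequalities.
Variable R : realType.
Implicit Types (m p j i : nat).

Lemma bin_succ_ratio m i :
  i.+1%:R * 'C(m, i.+1)%:R = (m%:R - i%:R) * 'C(m, i)%:R :> R.
Proof.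
have [im|mi] := leqP i m; last by rewrite !bin_small// 1?ltnW// !mulr0.
by rewrite -natrB// -!natrM mul_bin_left.
Qed.

(* Once nonpositive, [d] would decrease at least like [- 8 ^ p]. *)
Lemma backward_pos (d : nat -> R) (K : R) (N : nat) :
    (forall p, (N <= p)%N -> d p.+1 < 8 * d p) ->
    (forall p, - d p <= K * (27 / 4) ^+ p) ->
  forall p, (N <= p)%N -> 0 < d p.
Proof.
move=> dS dK p Np; rewrite ltNge; apply/negP => dp0.
(* [d p] may vanish, but the next term is strictly negative and gives [e > 0]. *)
pose q := p.+1; pose e := - d q.
have e0 : 0 < e by rewrite /e oppr_gt0 (lt_le_trans (dS _ Np))//; nra.
have de n : d (q + n)%N <= - e * 8 ^+ n.
  elim: n => [|n IHn]; first by rewrite addn0 expr0 /e opprK mulr1.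
  rewrite addnS exprS mulrCA (le_trans (ltW (dS _ _)))//.
    by rewrite /q; lia.
  by rewrite ler_wpM2l.
(* The growth bound divided by [8 ^ n]: since [27 / 32 = (27 / 4) / 8 < 1], the right-hand side
   tends to [0]. *)
have eK n : e <= (K * (27 / 4) ^+ q) * (27 / 32) ^+ n.
  rewrite -(ler_pM2r (exprn_gt0 n (_ : 0 < 8 :> R)))//.
  have -> : K * (27 / 4) ^+ q * (27 / 32) ^+ n * 8 ^+ n
          = K * (27 / 4) ^+ (q + n) :> R.
    rewrite exprD -!mulrA -exprMn; congr (_ * (_ * _ ^+ _)); lra.
  by rewrite (le_trans _ (dK _))// -[leLHS]opprK -mulNr lerN2.
suff : e <= 0 by rewrite leNgt e0.
rewrite -(mulr0 (K * (27 / 4) ^+ q)).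
have cv : (fun n => K * (27 / 4) ^+ q * (27 / 32) ^+ n) @ \oo
          --> K * (27 / 4) ^+ q * (0 : R).
  apply: cvgM; first exact: cvg_cst.
  by apply: cvg_expr; rewrite ger0_norm; lra.
rewrite -(cvg_lim _ cv)//; apply: limr_ge.
  by apply/cvg_ex; eexists; exact: cv.
by near=> n; exact: eK.
Unshelve. all: end_near. Qed.

(** For [m = 3 p + j], this is [2 ^ (p + 1)] times the distance from [fm] to its upper bound;
    [lower_gap] is the same for the lower bound. *)
Definition upper_gap j p : R :=
  2 * 'C(3 * p + j, p.+1)%:R - (binsum (3 * p + j) p.+1)%:R.

Definition lower_gap j p : R :=
  (binsum (3 * p + j) p.+1)%:R - 'C(3 * p + j, p.+2)%:R.

(** Chernoff-type bound: weighting the terms by [2 ^ (r - i) >= 1] and summing over all [i] gives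
    [2 ^ r * (1 + 1 / 2) ^ m]. The induction uses the same factor [1 + 1 / 2]. *)
Lemma binsum_le_exp m r : (binsum m r)%:R <= (3 / 2) ^+ m * 2 ^+ r :> R.
Proof.
elim: m r => [|m IHm] [|r].
- by rewrite binsumn0 !expr0 mulr1.
- by rewrite binsum0n expr0 mul1r exprn_ege1 ?ler1n.
- by rewrite binsumn0 expr0 mulr1 exprn_ege1//; lra.
- have := IHm r; have := IHm r.+1; rewrite binsumSS natrD !exprS; lra.
Qed.

(** Here [27 / 4 = (3 / 2) ^ 3 * 2], and [9] is [4 * (3 / 2) ^ j] at [j = 2]. The index [p + 2] lets
    the bound cover the negatives of both gaps. *)
Lemma binsum_growth j p : (j <= 2)%N ->
  (binsum (3 * p + j) p.+2)%:R <= 9 * (27 / 4) ^+ p :> R.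
Proof.
move=> j2; apply: le_trans (binsum_le_exp _ _) _.
have -> : (3 / 2) ^+ (3 * p + j) * 2 ^+ p.+2
        = 4 * (3 / 2) ^+ j * (27 / 4) ^+ p :> R.
  rewrite (_ : 27 / 4 = (3 / 2) ^+ 3 * 2); last by field.
  rewrite (exprMn p (_ ^+ 3)) exprD exprM -[p.+2]addn2 (exprD 2) expr2.
  by move: ((3 / 2) ^+ 3 ^+ p) ((3 / 2) ^+ j) (2 ^+ p) => u v w; ring.
rewrite ler_wpM2r ?exprn_ge0//.
by case: j j2 => [|[|[|]]] // _; rewrite ?expr0 ?expr1 ?expr2; lra.
Qed.

Lemma binsum_stepr m r :
  (binsum m.+3 r.+2)%:R = 8 * (binsum m r.+1)%:R + 'C(m, r.+2)%:R
    - 4 * 'C(m, r.+1)%:R - 'C(m, r)%:R :> R.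
Proof.
have /(congr1 (fun n => n%:R : R)) := binsum_step m r.
by rewrite !(natrD, natrM) => h; lra.
Qed.

Lemma binS3 m i :
  'C(m.+3, i.+3)%:R = 'C(m, i.+3)%:R + 3 * 'C(m, i.+2)%:R
    + 3 * 'C(m, i.+1)%:R + 'C(m, i)%:R :> R.
Proof. by rewrite !binS !natrD; lra. Qed.

(** With [m = 3 p + j], the combination on the left is [8 * upper_gap j p - upper_gap j (p + 1)] for
    [i = p - 1], and [lower_gap j (p + 1) - 8 * lower_gap j p] for [i = p]. Both gap steps thus
    reduce to the sign of one polynomial. *)
Lemma bin_four_terms m i (n := m%:R : R) (x := i%:R : R) :
  (x + 1) * (x + 2) * (x + 3) *
    (6 * 'C(m, i.+2)%:R - 'C(m, i.+3)%:R - 7 * 'C(m, i.+1)%:R - 2 * 'C(m, i)%:R)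
  = 'C(m, i)%:R *
    (6 * (n - x) * (n - x - 1) * (x + 3) - (n - x) * (n - x - 1) * (n - x - 2)
     - 7 * (n - x) * (x + 2) * (x + 3) - 2 * (x + 1) * (x + 2) * (x + 3)).
Proof.
have := bin_succ_ratio m i; have := bin_succ_ratio m i.+1.
have := bin_succ_ratio m i.+2.
move: 'C(m, i)%:R 'C(m, i.+1)%:R 'C(m, i.+2)%:R 'C(m, i.+3)%:R => w a b c.
rewrite -[i.+3]addn3 -[i.+2]addn2 -[i.+1]addn1 !natrD -/x -/n => Ec Eb Ea.
have x0 : 0 <= x by rewrite /x ler0n.
have -> : c = (n - (x + 2)) * b / (x + 3).
  by rewrite -Ec mulrAC divff ?mul1r// gt_eqF//; lra.
have -> : b = (n - (x + 1)) * a / (x + 2).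
  by rewrite -Eb mulrAC divff ?mul1r// gt_eqF//; lra.
have -> : a = (n - x) * w / (x + 1).
  by rewrite -Ea mulrAC divff ?mul1r// gt_eqF//; lra.
field.
by apply/and3P; split; rewrite gt_eqF//; lra.
Qed.

Lemma upper_gap_step j p : (j <= 2)%N -> ((if j is 0 then 6 else 1) <= p)%N ->
  upper_gap j p.+1 < 8 * upper_gap j p.
Proof.
move=> j2; case: p => [|q]; first by case: j {j2}.
move=> pj; rewrite /upper_gap.
have -> : (3 * q.+2 + j = (3 * q.+1 + j).+3)%N by lia.
have [m mE] : {m | m = 3 * q.+1 + j}%N by exists (3 * q.+1 + j)%N.
have w0 : 0 < 'C(m, q)%:R :> R by rewrite ltr0n bin_gt0; lia.
have x0 : 0 <= q%:R :> R by rewrite ler0n.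
rewrite -mE binsum_stepr binS3.
suff : 0 < 6 * 'C(m, q.+2)%:R - 'C(m, q.+3)%:R - 7 * 'C(m, q.+1)%:R
        - 2 * 'C(m, q)%:R :> R by lra.
have c0 : 0 < (q%:R + 1) * (q%:R + 2) * (q%:R + 3) :> R.
  by rewrite !mulr_gt0//; lra.
rewrite -(pmulr_rgt0 _ c0) bin_four_terms pmulr_rgt0//.
have -> : m%:R = 3 * (q%:R + 1) + j%:R :> R.
  by rewrite mE natrD natrM [q.+1%:R]mulrSr.
(* The cubic terms cancel. For [j = 0] there remains [5 q ^ 2 - 17 q - 36], which is positive only
   from [q = 5] on, hence the condition [6 <= p]. *)
move: pj; case: j j2 mE => [|[|[|//]]] _ _ qj.
- have : (5 <= q)%N by lia.
  by rewrite -(ler_nat R) => h; nra.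
- by nra.
- by nra.
Qed.

Lemma lower_gap_step j p : (j <= 2)%N -> lower_gap j p.+1 < 8 * lower_gap j p.
Proof.
move=> j2; rewrite /lower_gap.
have -> : (3 * p.+1 + j = (3 * p + j).+3)%N by lia.
have [m mE] : {m | m = 3 * p + j}%N by exists (3 * p + j)%N.
have w0 : 0 < 'C(m, p)%:R :> R by rewrite ltr0n bin_gt0; lia.
have x0 : 0 <= p%:R :> R by rewrite ler0n.
rewrite -mE binsum_stepr binS3.
suff : 6 * 'C(m, p.+2)%:R - 'C(m, p.+3)%:R - 7 * 'C(m, p.+1)%:R
        - 2 * 'C(m, p)%:R < 0 :> R by lra.
have c0 : 0 < (p%:R + 1) * (p%:R + 2) * (p%:R + 3) :> R.
  by rewrite !mulr_gt0//; lra.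
rewrite -(pmulr_rlt0 _ c0) bin_four_terms pmulr_rlt0//.
have -> : m%:R = 3 * p%:R + j%:R :> R by rewrite mE natrD natrM.
(* The cubic terms cancel again, and for [j = 2] the quadratic ones too; what remains is negative
   for every [p]. *)
by case: j j2 mE => [|[|[|//]]] _ _; nra.
Qed.

Lemma upper_gap_gt0 j p : (j <= 2)%N ->
    (3 * p + j \notin [:: 0; 1; 3; 6; 9; 12])%N ->
  0 < upper_gap j p.
Proof.
move=> j2 nj; have nat_gap n r : (binsum n r < 2 * 'C(n, r))%N ->
    0 < 2 * 'C(n, r)%:R - (binsum n r)%:R :> R.
  by rewrite subr_gt0 -natrM ltr_nat.
have [pj|pj] := leqP (if j is 0 then 6 else 1)%N p.
  apply: (@backward_pos _ 9 _ _ _ p pj) => {nj pj p} p.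
    exact: upper_gap_step.
  rewrite (le_trans _ (binsum_growth j p j2))// binsum_succ natrD /upper_gap.
  have : 0 <= 'C(3 * p + j, p.+1)%:R :> R by rewrite ler0n.
  have : 0 <= 'C(3 * p + j, p.+2)%:R :> R by rewrite ler0n.
  by lra.
apply: nat_gap; move: nj pj.
case: j j2 => [|[|[|//]]] _; case: p => [|[|[|[|[|[|[|]]]]]]]// _ _;
  by rewrite /binsum !big_nat_recr//= big_nil.
Qed.

Lemma lower_gap_gt0 j p : (j <= 2)%N -> 0 < lower_gap j p.
Proof.
move=> j2; apply: (@backward_pos _ 9 0) => // {}p.
  by move=> _; exact: lower_gap_step.
rewrite (le_trans _ (binsum_growth j p j2))// binsum_succ natrD /lower_gap.
have : 0 <= (binsum (3 * p + j) p.+1)%:R :> R by rewrite ler0n.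
by lra.
Qed.

End real_inequalities.

(** * Wallis integrals *)

Section wallis.
Variable R : realType.
Let mu := @lebesgue_measure R.

Lemma Rintegral_is_derive (F f : R -> R) (a b : R) : a < b ->
    (forall x : R, is_derive x 1 F (f x)) -> continuous f ->
  \int[mu]_(x in `[a, b]) f x = F b - F a.
Proof.
move=> ab dF cf; have cF : continuous F.
  by move=> x; apply/differentiable_continuous/derivable1_diffP.
rewrite /Rintegral (@continuous_FTC2 _ f F)//.
- exact: continuous_subspaceT.
- split=> [x _| |]; first exact: ex_derive.
  + by apply: cvg_at_right_filter; exact: cF.
  + by apply: cvg_at_left_filter; exact: cF.
- by move=> x _; rewrite derive1E derive_val.
Qed.

Lemma continuous_cosX n : continuous (fun x : R => cos x ^+ n).
Proof.
move=> x; apply: (@continuous_comp _ _ _ cos (fun y : R => y ^+ n)).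
  exact: continuous_cos.
exact: exprn_continuous.
Qed.

Lemma integrable_cosX n (a b : R) :
  mu.-integrable `[a, b] (EFin \o (fun x : R => cos x ^+ n)).
Proof.
apply: continuous_compact_integrable; first exact: segment_compact.
by apply: continuous_subspaceT; exact: continuous_cosX.
Qed.

Definition wallis n : R := \int[mu]_(x in `[0, pi / 2]) cos x ^+ n.

Lemma wallis0 : wallis 0 = pi / 2.
Proof.
rewrite /wallis (@Rintegral_is_derive id) ?divr_gt0 ?pi_gt0//.
- by rewrite subr0.
- exact: continuous_cosX.
Qed.

Lemma wallis1 : wallis 1 = 1.
Proof.
rewrite /wallis (@Rintegral_is_derive sin) ?divr_gt0 ?pi_gt0//.
- by rewrite sin_pihalf sin0 subr0.
- exact: continuous_cosX.
Qed.

(** The difference of the two sides integrates the derivative of [sin * cos ^ (n + 1)], which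
    vanishes at both endpoints. *)
Lemma wallis_rec n : n.+2%:R * wallis n.+2 = n.+1%:R * wallis n.
Proof.
apply/eqP; rewrite -subr_eq0; apply/eqP.
rewrite /wallis -!RintegralZl ?integrable_cosX// -RintegralB//; first last.
- apply: continuous_compact_integrable; first exact: segment_compact.
  apply: continuous_subspaceT => x.
  by apply: cvgM; [exact: cvg_cst|exact: continuous_cosX].
- apply: continuous_compact_integrable; first exact: segment_compact.
  apply: continuous_subspaceT => x.
  by apply: cvgM; [exact: cvg_cst|exact: continuous_cosX].
have dF (x : R) : is_derive x 1 (@sin R * @cos R ^+ n.+1)
    (n.+2%:R * cos x ^+ n.+2 - n.+1%:R * cos x ^+ n).
  apply: is_derive_eq; rewrite /GRing.scale/= exprfctE.
  have := cos2Dsin2 x; rewrite [n.+2%:R]mulrSr !(exprS _ n.+1) !(exprS _ n).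
  move: (cos x) (sin x) (cos x ^+ n) => c s t; move: n.+1%:R => k cs1.
  rewrite [X in _ - X](_ : _ = k * t * (c ^+ 2 + s ^+ 2)); last first.
    by rewrite cs1 mulr1.
  ring.
have pi20 : 0 < pi / 2 :> R by rewrite divr_gt0 ?pi_gt0.
rewrite (Rintegral_is_derive _ _ _ _ pi20 dF).
- by rewrite !mulrfctE !exprfctE cos_pihalf sin0 exprS !(mul0r, mulr0) subrr.
- move=> x; apply: cvgB; apply: cvgM; by [exact: cvg_cst|exact: continuous_cosX].
Qed.

Lemma wallis_decr n : wallis n.+1 <= wallis n.
Proof.
apply: le_Rintegral; rewrite ?integrable_cosX// => x /=.
rewrite in_itv/= => /andP[x0 x2].
have c0 : 0 <= cos x.
  by rewrite cos_ge0_pihalf// x2 andbT (le_trans _ x0)// oppr_le0 divr_ge0// pi_ge0.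
by rewrite exprS ler_piMl ?exprn_ge0// cos_le1.
Qed.

(** By [wallis_rec] the left-hand side does not depend on [n]. *)
Lemma wallis_prod n : n.+1%:R * (wallis n.+1 * wallis n) = pi / 2.
Proof.
elim: n => [|n IHn]; first by rewrite wallis0 wallis1 !mul1r.
by rewrite mulrA wallis_rec -IHn; ring.
Qed.

(** This is [binomial (2 n, n) / 4 ^ n]. *)
Definition central n : R := (2 * n)`!%:R / (4 ^+ n * n`!%:R ^+ 2).

Lemma wallis_even n : wallis (2 * n) = pi / 2 * central n.
Proof.
elim: n => [|n IHn].
  by rewrite muln0 wallis0 /central muln0 fact0 !expr0 expr1n mulr1 divr1 mulr1.
have n0 : n.+1%:R != 0 :> R by rewrite pnatr_eq0.
have f0 : n`!%:R != 0 :> R by rewrite pnatr_eq0 -lt0n fact_gt0.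
have e0 : 4 ^+ n != 0 :> R by rewrite expf_neq0// pnatr_eq0.
have := wallis_rec (2 * n); rewrite (_ : (2 * n).+2 = 2 * n.+1)%N; last by lia.
rewrite IHn => h.
have d0 : (2 * n.+1)%:R != 0 :> R by rewrite pnatr_eq0.
apply: (mulfI d0); rewrite h /central.
rewrite (_ : (2 * n.+1)`! = (2 * n.+1) * ((2 * n).+1 * (2 * n)`!))%N; last first.
  by rewrite (_ : 2 * n.+1 = (2 * n).+2)%N ?factS//; lia.
rewrite factS [4 ^+ n.+1]exprS !natrM.
move: (2 * n).+1%:R (2 * n)`!%:R => u v.
move: f0 e0 n0; move: n`!%:R (4 ^+ n) n.+1%:R => a b c a0 b0 c0.
by field; rewrite a0 b0 c0.
Qed.

Lemma central_cvg : (fun n => central n ^+ 2 * n%:R) @ \oo --> (pi : R)^-1.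
Proof.
have pi0 : 0 < pi :> R := pi_gt0 R.
have w0 n : 0 <= wallis n.
  apply: Rintegral_ge0 => x /=.
  rewrite in_itv/= => /andP[x0 x2]; rewrite exprn_ge0//.
  by rewrite cos_ge0_pihalf// x2 andbT (le_trans _ x0)// oppr_le0 divr_ge0// ltW.
have cE n : central n = 2 / pi * wallis (2 * n).
  rewrite wallis_even mulrA mulf_div [pi * 2]mulrC divff ?mul1r//.
  by rewrite mulf_neq0// gt_eqF.
(* Comparing [wallis (2 n)] with its two neighbours through [wallis_prod] puts
   [n * wallis (2 n) ^ 2] between [pi / 4 * (2 n / (2 n + 1))] and [pi / 4]; the lower bound is
   weakened to the factor [n / (n + 1)]. *)
apply: (@squeeze_cvgr _ _ _ _ (fun n => pi^-1 * (1 - n.+1%:R^-1)) (cst pi^-1)).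
- near=> n; have n0 : (0 < n)%N by near: n; exists 1%N.
  have nR : 0 < n%:R :> R by rewrite ltr0n.
  have h1 := wallis_prod (2 * n).
  have : (2 * n)%:R * (wallis (2 * n) * wallis (2 * n).-1) = pi / 2.
    by rewrite -(wallis_prod (2 * n).-1) prednK// muln_gt0.
  have : wallis (2 * n) <= wallis (2 * n).-1.
    by rewrite -[in leLHS](@prednK (2 * n)) ?muln_gt0// wallis_decr.
  have := wallis_decr (2 * n); have := w0 (2 * n)%N.
  move: h1; rewrite cE [(2 * n).+1%:R]mulrSr natrM [n.+1%:R]mulrSr.
  move: (wallis (2 * n)) (wallis (2 * n).+1) (wallis (2 * n).-1).
  move=> w u v uE w0' uw wv vE.
  have hi : w ^+ 2 * n%:R <= pi / 4.
    have : w * w * n%:R <= w * v * n%:R by rewrite ler_wpM2r ?ler_wpM2l// ltW.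
    by rewrite expr2; nra.
  have lo : pi / 2 <= (2 * n%:R + 1) * w ^+ 2.
    by rewrite expr2 -uE ler_wpM2l ?ler_wpM2r//; lra.
  have -> : (2 / pi * w) ^+ 2 * n%:R = pi^-1 * (w ^+ 2 * n%:R / (pi / 4)).
    by move: pi0; move: (pi : R) => p p0; field; rewrite gt_eqF.
  apply/andP; split; last first.
    by rewrite ger_pMr ?invr_gt0// ler_pdivrMr ?mul1r// divr_gt0.
  rewrite ler_pM2l ?invr_gt0// ler_pdivlMr ?divr_gt0//.
  have -> : 1 - (n%:R + 1)^-1 = n%:R / (n%:R + 1) :> R.
    by field; rewrite gt_eqF// addr_gt0.
  rewrite mulrAC ler_pdivrMr ?addr_gt0//.
  by nra.
- have h : (fun n => pi^-1 * (1 - n.+1%:R^-1)) @ \oo --> pi^-1 * (1 - 0 : R).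
    apply: cvgM; first exact: cvg_cst.
    by apply: cvgB; [exact: cvg_cst|exact: cvg_harmonic].
  by rewrite subr0 mulr1 in h.
- exact: cvg_cst.
Unshelve. all: end_near. Qed.

End wallis.

(** * Stirling's formula *)

Section stirling.
Variable R : realType.

Lemma ge1_derive_le (f df : R -> R) :
    (forall x : R, 1 <= x -> is_derive x 1 f (df x)) ->
    (forall x, 1 <= x -> 0 <= df x) ->
  forall y, 1 <= y -> f 1 <= f y.
Proof.
move=> fdf df0 y y1.
have dfx (x : R) : x \in `]1, +oo[ -> is_derive x 1 f (df x).
  by rewrite in_itv/= andbT => /ltW; exact: fdf.
apply: (@ger0_derive1_ndecry _ f 1) => //.
- by move=> x /dfx ?; exact: ex_derive.
- move=> x x1; have ? := dfx _ x1; rewrite derive1E derive_val.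
  by apply: df0; move: x1; rewrite in_itv/= andbT => /ltW.
- apply: derivable_within_continuous => x; rewrite in_itv/= andbT => x1.
  by have ? := fdf _ x1; exact: ex_derive.
Qed.

(** Both sides vanish at [1], and the derivative of their difference is a square over a positive
    quantity. The rational function is the Pade approximant of [ln] at [1], of type [(1, 1)]. *)
Lemma ln_ge_pade (y : R) : 1 <= y -> 2 * (y - 1) / (y + 1) <= ln y.
Proof.
move=> y1; rewrite -subr_ge0.
pose f : R -> R :=
  @ln R - (cst 2 - cst 4 * (fun y => ((id + cst 1 : R -> R) y)^-1)).
have df (x : R) : 1 <= x ->
    is_derive x 1 f (x^-1 - 4 / (x + 1) ^+ 2).
  move=> x1; have x0 : 0 < x by exact: lt_le_trans x1.
  have x10 : (id + cst 1 : R -> R) x != 0 by rewrite /= gt_eqF// addr_gt0.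
  have ? := is_derive1_ln x0.
  have ? := is_deriveV x10
    (is_deriveD (is_derive_id x (1 : R)) (is_derive_cst (1 : R) x 1)).
  apply: is_derive_eq; rewrite /GRing.scale/= !addrfctE/=.
  by field; rewrite !gt_eqF// addr_gt0.
have -> : ln y - 2 * (y - 1) / (y + 1) = f y - f 1.
  rewrite /f !(addrfctE, mulrfctE, opprfctE)/= ln1.
  by field; rewrite gt_eqF//; lra.
rewrite subr_ge0; apply: (ge1_derive_le _ _ df) => // x x1.
have -> : x^-1 - 4 / (x + 1) ^+ 2 = (x - 1) ^+ 2 / (x * (x + 1) ^+ 2).
  by field; rewrite !gt_eqF//; lra.
by rewrite divr_ge0 ?sqr_ge0// mulr_ge0 ?sqr_ge0//; lra.
Qed.

(** With [y = exp t], this is [t <= sinh t]. *)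
Lemma ln_le_sinh (y : R) : 1 <= y -> ln y <= (y - y^-1) / 2.
Proof.
move=> y1; rewrite -subr_ge0.
pose f : R -> R := cst 2^-1 * (id - (fun y => (id y)^-1)) - @ln R.
have df (x : R) : 1 <= x -> is_derive x 1 f ((1 + x ^- 2) / 2 - x^-1).
  move=> x1; have x0 : 0 < x by exact: lt_le_trans x1.
  have xn0 : id x != 0 by rewrite /= gt_eqF.
  have ? := is_derive1_ln x0.
  have ? := is_deriveV xn0 (is_derive_id x (1 : R)).
  apply: is_derive_eq; rewrite /GRing.scale/= !addrfctE/=.
  by field; rewrite gt_eqF.
have -> : (y - y^-1) / 2 - ln y = f y - f 1.
  rewrite /f !(addrfctE, mulrfctE, opprfctE)/= ln1.
  by field; rewrite gt_eqF//; lra.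
rewrite subr_ge0; apply: (ge1_derive_le _ _ df) => // x x1.
have -> : (1 + x ^- 2) / 2 - x^-1 = (1 - x^-1) ^+ 2 / 2.
  by field; rewrite !gt_eqF//; lra.
by rewrite divr_ge0 ?sqr_ge0.
Qed.

(** For [n > 0], the logarithm of [n! / (sqrt n * (n / e) ^ n)]. *)
Definition stirling_log n : R :=
  ln n`!%:R - (n%:R + 2^-1) * ln n%:R + n%:R.

(** The difference is [(x + 1 / 2) * ln ((x + 1) / x) - 1]. There the Pade bound gives exactly [0],
    and the [sinh] bound exactly the telescoping right-hand side. *)
Lemma stirling_log_step n (x := n.+1%:R : R) :
  0 <= stirling_log n.+1 - stirling_log n.+2 <= 4^-1 * (x^-1 - (x + 1)^-1).
Proof.
have x0 : 0 < x by rewrite /x ltr0n.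
have x1 : 0 < x + 1 by rewrite addr_gt0.
have y1 : 1 <= (x + 1) / x by rewrite ler_pdivlMr// mul1r lerDl.
have -> : stirling_log n.+1 - stirling_log n.+2
        = (x + 2^-1) * ln ((x + 1) / x) - 1.
  rewrite /stirling_log [n.+2`!]factS natrM lnM ?posrE ?ltr0n ?fact_gt0//.
  rewrite ln_div ?posrE// (_ : n.+2%:R = x + 1); last by rewrite [n.+2%:R]mulrSr.
  by rewrite -/x; lra.
have := ln_ge_pade _ y1; have := ln_le_sinh _ y1.
move: (ln _) => l hl hu; apply/andP; split.
- have e1 : (x + 2^-1) * (2 * ((x + 1) / x - 1) / ((x + 1) / x + 1)) = 1.
    by field; rewrite !gt_eqF//; lra.
  by rewrite subr_ge0 -[leLHS]e1 ler_wpM2l//; lra.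
- rewrite lerBlDr; apply: (le_trans
    (_ : _ <= (x + 2^-1) * (((x + 1) / x - ((x + 1) / x)^-1) / 2))).
    by rewrite ler_wpM2l//; lra.
  rewrite le_eqVlt; apply/orP; left; apply/eqP.
  by field; rewrite !gt_eqF//; lra.
Qed.

Lemma stirling_log_cvg : cvgn stirling_log.
Proof.
suff h : cvgn [sequence stirling_log n.+1]_n.
  by apply/cvg_ex; case/cvg_ex: h => l; rewrite cvg_shiftS => hl; exists l.
apply: nonincreasing_is_cvgn.
  apply/nonincreasing_seqP => n /=.
  by have /andP[+ _] := stirling_log_step n; rewrite subr_ge0.
(* Subtracting the telescoping bound reverses the monotonicity, so [v 0] is a lower bound of the
   sequence. *)
pose v n : R := stirling_log n.+1 - 4^-1 * n.+1%:R^-1.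
have vS : nondecreasing_seq v.
  apply/nondecreasing_seqP => n; rewrite /v.
  have /andP[_] := stirling_log_step n; rewrite [n.+2%:R]mulrSr.
  by move: (n.+1%:R^-1) ((n.+1%:R + 1)^-1) => a b; lra.
exists (v 0%N) => _ [n _ <-] /=; apply: (le_trans (vS 0%N n _)) => //.
by rewrite /v gerBl mulr_ge0.
Qed.

End stirling.

(** * Stirling's constant and the asymptotics of [binomial (3 n, n)] *)

Section binomial_asymptotics.
Variable R : realType.

Lemma cvg_affine (u : nat -> R) (l : R) (a b : nat) : (0 < a)%N ->
  u @ \oo --> l -> (fun n => u (a * n + b)%N) @ \oo --> l.
Proof.
move=> a0; apply: (@cvg_comp _ _ _ (fun n => (a * n + b)%N) u).
move=> P [N _ NP]; exists N => // n /= Nn; apply: NP => /=.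
by rewrite (leq_trans Nn)// (leq_trans (leq_pmull n a0))// leq_addr.
Qed.

(* The square of [n! / (sqrt n * (n / e) ^ n)]. *)
Definition stirling_sq n : R :=
  n`!%:R ^+ 2 * expR n%:R ^+ 2 / n%:R ^+ (2 * n).+1.

Lemma stirling_sqE n : (0 < n)%N ->
  stirling_sq n = expR (2 * stirling_log R n).
Proof.
move=> n0; have x0 : 0 < n%:R :> R by rewrite ltr0n.
have f0 : 0 < n`!%:R :> R by rewrite ltr0n fact_gt0.
have -> : 2 * stirling_log R n
    = ln n`!%:R * 2%:R + n%:R * 2%:R - ln n%:R * (2 * n).+1%:R.
  by rewrite /stirling_log [(2 * n).+1%:R]mulrSr natrM; lra.
by rewrite expRB expRD !expRM_natr !lnK.
Qed.

Lemma stirling_sq_cvg_pos : exists2 d : R, 0 < d & stirling_sq @ \oo --> d.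
Proof.
have /cvg_ex[l hl] := @stirling_log_cvg R.
exists (expR (2 * l)); first exact: expR_gt0.
apply: cvg_trans (_ : (fun n => expR (2 * stirling_log R n)) @ \oo --> _).
  apply: near_eq_cvg; near=> n.
  by rewrite stirling_sqE//; near: n; exists 1%N.
apply: continuous_cvg; first exact: continuous_expR.
by apply: cvgM; [exact: cvg_cst|exact: hl].
Unshelve. all: end_near. Qed.

(** The powers of [a * n] are split into powers of [a] and of [n], so that [field] can treat these
    as atoms in the quotients below. *)
Lemma stirling_sqM a n (x := n%:R : R) :
  stirling_sq (a * n) = (a * n)`!%:R ^+ 2 * (expR x ^+ 2) ^+ a
    / (a%:R * x * (((a%:R ^+ a) ^+ n) ^+ 2 * (x ^+ (2 * n)) ^+ a)).
Proof.
rewrite /stirling_sq natrM expRM_natl exprMn !(exprS _ (2 * _)) -!exprM.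
rewrite (mulnC a 2%N) (_ : a * (n * 2) = 2 * (a * n))%N; last by lia.
rewrite (_ : 2 * n * a = 2 * (a * n))%N; last by lia.
by congr (_ / _); rewrite -/x; ring.
Qed.

(** The exponentials and the powers of [n] cancel, which ties Stirling's constant to Wallis'
    limit. *)
Lemma central_stirling n : (0 < n)%N ->
  stirling_sq (2 * n) / stirling_sq n ^+ 2 = central R n ^+ 2 * n%:R / 2.
Proof.
move=> n0; have x0 : n%:R != 0 :> R by rewrite pnatr_eq0 -lt0n.
have f0 : n`!%:R != 0 :> R by rewrite pnatr_eq0 -lt0n fact_gt0.
have e0 : expR n%:R != 0 :> R by rewrite gt_eqF// expR_gt0.
have p0 : n%:R ^+ (2 * n) != 0 :> R by rewrite expf_neq0.
have q0 : (2 ^+ 2) ^+ n != 0 :> R by rewrite !expf_neq0// pnatr_eq0.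
rewrite stirling_sqM /stirling_sq /central (exprS _ (2 * n)).
rewrite (_ : 4 = 2 ^+ 2 :> R); last by ring.
move: x0 f0 e0 p0 q0; move: (expR _) (n%:R ^+ (2 * n)) ((2 ^+ 2) ^+ n) => e p q.
move: n%:R n`!%:R (2 * n)`!%:R => x f g *.
by field; do ?[apply/andP; split].
Qed.

Lemma trinomial_stirling n : (0 < n)%N ->
  stirling_sq (3 * n) / (stirling_sq n * stirling_sq (2 * n))
  = ('C(3 * n, n)%:R * (4 / 27) ^+ n) ^+ 2 * n%:R * (2 / 3).
Proof.
move=> n0; have x0 : n%:R != 0 :> R by rewrite pnatr_eq0 -lt0n.
have f0 : n`!%:R != 0 :> R by rewrite pnatr_eq0 -lt0n fact_gt0.
have g0 : (2 * n)`!%:R != 0 :> R by rewrite pnatr_eq0 -lt0n fact_gt0.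
have e0 : expR n%:R != 0 :> R by rewrite gt_eqF// expR_gt0.
have p0 : n%:R ^+ (2 * n) != 0 :> R by rewrite expf_neq0.
have q0 : (2 ^+ 2) ^+ n != 0 :> R by rewrite !expf_neq0// pnatr_eq0.
have r0 : (3 ^+ 3) ^+ n != 0 :> R by rewrite !expf_neq0// pnatr_eq0.
have -> : 'C(3 * n, n)%:R = (3 * n)`!%:R / (n`!%:R * (2 * n)`!%:R) :> R.
  rewrite -(@bin_fact (3 * n) n) ?leq_pmull//.
  rewrite (_ : (3 * n - n = 2 * n)%N); last by lia.
  by rewrite !natrM mulfK// mulf_neq0.
rewrite !stirling_sqM /stirling_sq (exprS _ (2 * n)) expr_div_n.
rewrite (_ : 4 = 2 ^+ 2 :> R); last by ring.
rewrite (_ : 27 = 3 ^+ 3 :> R); last by ring.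
move: x0 f0 g0 e0 p0 q0 r0.
move: (expR _) (n%:R ^+ (2 * n)) ((2 ^+ 2) ^+ n) ((3 ^+ 3) ^+ n) => e p q r.
move: n%:R n`!%:R (2 * n)`!%:R (3 * n)`!%:R => x f g h *.
by field; do ?[apply/andP; split].
Qed.

(** If [d] is the limit, the quotient in [central_stirling] tends both to [1 / d] and to
    [1 / (2 pi)]. *)
Lemma stirling_sq_cvg : stirling_sq @ \oo --> (2 * pi : R).
Proof.
have [d d0 Td] := stirling_sq_cvg_pos.
suff -> : 2 * pi = d by [].
have pi0 : 0 < pi :> R := pi_gt0 R.
have T2 : (fun n => stirling_sq (2 * n)) @ \oo --> d.
  by have := @cvg_affine _ _ 2 0 isT Td; under eq_fun do rewrite addn0.
have h1 : (fun n => stirling_sq (2 * n) / stirling_sq n ^+ 2) @ \oo --> d / d ^+ 2.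
  apply: cvgM => //; apply: cvgV; first by rewrite expf_neq0// gt_eqF.
  by rewrite expr2; under eq_fun do rewrite expr2; exact: cvgM.
have h2 : (fun n => stirling_sq (2 * n) / stirling_sq n ^+ 2) @ \oo --> pi^-1 / 2.
  apply: cvg_trans (_ : (fun n => central R n ^+ 2 * n%:R / 2) @ \oo --> _).
    apply: near_eq_cvg; near=> n.
    by rewrite central_stirling//; near: n; exists 1%N.
  by apply: cvgM; [exact: central_cvg|exact: cvg_cst].
have := cvg_unique _ h1 h2.
move: pi0; move: (pi : R) => p p0 E.
have : (d / d ^+ 2) * (d * (2 * p)) = (p^-1 / 2) * (d * (2 * p)) by rewrite E.
have -> : (d / d ^+ 2) * (d * (2 * p)) = 2 * p by field; rewrite gt_eqF.
by have -> : (p^-1 / 2) * (d * (2 * p)) = d by field; rewrite gt_eqF.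
Unshelve. all: end_near. Qed.

Lemma trinomial_cvg :
  (fun n => ('C(3 * n, n)%:R * (4 / 27) ^+ n) ^+ 2 * n%:R) @ \oo --> 3 / (4 * pi : R).
Proof.
have pi0 : 0 < pi :> R := pi_gt0 R.
have T1 := stirling_sq_cvg.
have Ta a : (0 < a)%N -> (fun n => stirling_sq (a * n)) @ \oo --> (2 * pi : R).
  by move=> a0; have := @cvg_affine _ _ a 0 a0 T1; under eq_fun do rewrite addn0.
have h : (fun n => stirling_sq (3 * n)
      / (stirling_sq n * stirling_sq (2 * n)) * (3 / 2))
    @ \oo --> (2 * pi) / ((2 * pi) * (2 * pi)) * (3 / 2 : R).
  apply: cvgM; last exact: cvg_cst.
  apply: cvgM; first exact: Ta.
  apply: cvgV; first by rewrite gt_eqF// !mulr_gt0.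
  by apply: cvgM => //; exact: Ta.
have <- : (2 * pi) / ((2 * pi) * (2 * pi)) * (3 / 2 : R) = 3 / (4 * pi).
  by move: pi0; move: (pi : R) => p p0; field; rewrite gt_eqF.
apply: cvg_trans h; apply: near_eq_cvg; near=> n.
rewrite trinomial_stirling; last by near: n; exists 1%N.
by move: (_ ^+ 2) => t; field.
Unshelve. all: end_near. Qed.

End binomial_asymptotics.

(** * The threshold term *)

Section threshold_term.
Variable R : realType.

(* With [m = 3 * q + c] and [r = q + 1], the square of
   [2 ^- q * 'C(m, r) * (2 / 3) ^ m * sqrt m]; squaring avoids the root. *)
Definition term_sq c q : R :=
  (2 ^- q * 'C(3 * q + c, q.+1)%:R * (2 / 3) ^+ (3 * q + c)) ^+ 2
  * (3 * q + c)%:R.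

(** For [c = 3] the binomial is [binomial (3 n, n)] with [n = q + 1]. The factor [12] is [2 ^ 2],
    from [2 ^- q = 2 * 2 ^- n], times the [3] in [m = 3 n]. *)
Lemma term_sq3_cvg : term_sq 3 @ \oo --> 9 / (pi : R).
Proof.
have h := @cvg_affine R _ _ 1 1 isT (@trinomial_cvg R).
have h12 : (fun n => 12 * (('C(3 * (1 * n + 1), 1 * n + 1)%:R
    * (4 / 27) ^+ (1 * n + 1)) ^+ 2 * (1 * n + 1)%:R)) @ \oo
    --> 12 * (3 / (4 * pi : R)).
  by apply: cvgM; [exact: cvg_cst|exact: h].
have pi0 : 0 < pi :> R := pi_gt0 R.
have -> : 9 / pi = 12 * (3 / (4 * pi)) :> R.
  by move: pi0; move: (pi : R) => p p0; field; rewrite gt_eqF.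
apply: cvg_trans h12; apply: near_eq_cvg; near=> q => /=.
rewrite mul1n addn1 /term_sq (_ : 3 * q + 3 = 3 * q.+1)%N; last by lia.
have -> : 2 ^- q = 2 * 2 ^- q.+1 :> R by rewrite exprS; field; rewrite expf_neq0.
have -> : (2 / 3) ^+ (3 * q.+1) = (8 / 27) ^+ q.+1 :> R.
  by rewrite exprM; congr (_ ^+ _); field.
have -> : (8 / 27) ^+ q.+1 = 2 ^+ q.+1 * (4 / 27) ^+ q.+1 :> R.
  by rewrite -exprMn; congr (_ ^+ _); field.
have p0 : 2 ^+ q.+1 != 0 :> R by rewrite expf_neq0.
rewrite natrM; move: p0; move: (2 ^+ q.+1) ((4 / 27) ^+ q.+1) => p t p0.
by field.
Unshelve. all: end_near. Qed.

(** The ratios [(2 q + c) / (m + 1)] and [m / (m + 1)] are written as affine functions of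
    [h = 1 / (m + 1)], so the whole factor visibly tends to [1]. The limit thus descends from
    [c = 3] to the residues [0], [1], [2]. *)
Lemma term_sq_succ c q (h := (3 * q + c).+1%:R^-1 : R) :
  term_sq c q = term_sq c.+1 q
    * (((2 / 3 + (c%:R / 3 - 2 / 3) * h) * (3 / 2)) ^+ 2 * (1 - h)).
Proof.
have := mul_bin_down (3 * q + c).+1 q.+1; rewrite /= subSS.
rewrite (_ : 3 * q + c - q = 2 * q + c)%N; last by lia.
move/(congr1 (fun n => n%:R : R)); rewrite !natrM /term_sq addnS (exprS _ (3 * q + c)).
have m0 : (3 * q + c).+1%:R != 0 :> R by rewrite pnatr_eq0.
move: m0; rewrite /h.
have -> : (3 * q + c).+1%:R = 3 * q%:R + c%:R + 1 :> R.
  by rewrite [LHS]mulrSr natrD natrM.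
have -> : (3 * q + c)%:R = 3 * q%:R + c%:R :> R by rewrite natrD natrM.
have -> : (2 * q + c)%:R = 2 * q%:R + c%:R :> R by rewrite natrD natrM.
move: (2 ^- q) (_ ^+ (3 * q + c)) => p t m0 E.
have -> : 'C(3 * q + c, q.+1)%:R =
    (2 * q%:R + c%:R) * 'C((3 * q + c).+1, q.+1)%:R / (3 * q%:R + c%:R + 1) :> R.
  by rewrite -E mulrAC divff ?mul1r.
by field.
Qed.

Lemma term_sq_cvg c : (c <= 3)%N -> term_sq c @ \oo --> 9 / (pi : R).
Proof.
suff step d : term_sq d.+1 @ \oo --> 9 / (pi : R) ->
    term_sq d @ \oo --> 9 / (pi : R).
  have h3 := term_sq3_cvg; have h2 := step 2 h3; have h1 := step 1 h2.
  by have h0 := step 0 h1; case: c => [|[|[|[|]]]].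
move=> hd; rewrite (funext (term_sq_succ d)).
have hh : (fun q => (3 * q + d).+1%:R^-1) @ \oo --> (0 : R).
  exact: (@cvg_affine R _ _ 3 d isT (@cvg_harmonic R)).
have -> : 9 / pi = 9 / pi *
    (((2 / 3 + (d%:R / 3 - 2 / 3) * 0) * (3 / 2)) ^+ 2 * (1 - 0)) :> R.
  rewrite mulr0 addr0 subr0 mulr1 (_ : 2 / 3 * (3 / 2) = 1 :> R); last by field.
  by rewrite expr1n mulr1.
apply: cvgM => //; apply: cvgM; last by apply: cvgB; [exact: cvg_cst|exact: hh].
rewrite expr2; under eq_fun do rewrite expr2.
suff h : (fun q => (2 / 3 + (d%:R / 3 - 2 / 3) * (3 * q + d).+1%:R^-1) * (3 / 2)) @ \oo
     --> (2 / 3 + (d%:R / 3 - 2 / 3) * 0) * (3 / 2 : R) by exact: cvgM.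
apply: cvgM; last exact: cvg_cst.
by apply: cvgD; [exact: cvg_cst|apply: cvgM; [exact: cvg_cst|exact: hh]].
Qed.

(** Cleared of denominators, this says that [term_sq c] does not decrease from [q = x] to [q + 1].
    The constant [4 / 27] is [(2 / 3) ^ 3 / 2]. *)
Lemma term_ratio_le (c : nat) (x : R) (y := c%:R) (m := 3 * x + y) :
    (c <= 2)%N -> 0 <= x ->
  (27 * (x + 2) * (2 * x + y) * (2 * x + y + 1)) ^+ 2 * m
  <= (4 * (m + 3) * (m + 2) * (m + 1)) ^+ 2 * (m + 3).
Proof.
move=> c2 x0; have y0 : 0 <= y by rewrite /y ler0n.
have m0 : 0 <= m by rewrite /m; lra.
set D := 27 * _ * _ * _; set N := 4 * _ * _ * _.
have D0 : 0 <= D by rewrite /D !mulr_ge0//; lra.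
(* [(4 m + 9) / (4 m + 3)] is a Pade lower bound of [sqrt ((m + 3) / m)]. *)
have DN : D * (4 * m + 3) <= N * (4 * m + 9).
  by rewrite /D /N /m /y; case: c c2 {y y0 m m0 D N D0} => [|[|[|//]]] _; nra.
have mm : m * (4 * m + 9) ^+ 2 <= (m + 3) * (4 * m + 3) ^+ 2.
  by rewrite -subr_ge0 (_ : _ - _ = 27)//; ring.
have k0 : 0 < 4 * m + 3 by lra.
rewrite -(ler_pM2r (exprn_gt0 2 k0)).
apply: (@le_trans _ _ ((N * (4 * m + 9)) ^+ 2 * m)).
  have kD : 0 <= D * (4 * m + 3) by rewrite mulr_ge0// ltW.
  by rewrite mulrAC -exprMn ler_wpM2r// lerXn2r ?nnegrE// (le_trans kD).
have -> : (N * (4 * m + 9)) ^+ 2 * m = N ^+ 2 * (m * (4 * m + 9) ^+ 2).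
  by rewrite exprMn -(mulrA (N ^+ 2)) (mulrC m).
by rewrite -(mulrA (N ^+ 2)) ler_wpM2l ?sqr_ge0.
Qed.

(** One diagonal absorption step and two steps between rows, with no division. *)
Lemma bin_three_steps c q (x := q%:R : R) (y := c%:R) (m := 3 * x + y) :
  (x + 2) * (2 * x + y) * (2 * x + y + 1) * 'C((3 * q + c).+3, q.+2)%:R
  = (m + 3) * (m + 2) * (m + 1) * 'C(3 * q + c, q.+1)%:R.
Proof.
have mE i : (3 * q + c + i)%:R = m + i%:R :> R.
  by rewrite natrD (natrD _ (3 * q)) natrM.
have yE i : (2 * q + c + i)%:R = 2 * x + y + i%:R :> R.
  by rewrite natrD (natrD _ (2 * q)) natrM.
have m3 : (3 * q + c).+3%:R = m + 3 :> R by rewrite -addn3 mE.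
have m2 : (3 * q + c).+2%:R = m + 2 :> R by rewrite -addn2 mE.
have m1 : (3 * q + c).+1%:R = m + 1 :> R by rewrite -addn1 mE.
have x2 : q.+2%:R = x + 2 :> R by rewrite -addn2 natrD.
have n1 : (2 * q + c).+1%:R = 2 * x + y + 1 :> R by rewrite -addn1 yE.
have n0 : (2 * q + c)%:R = 2 * x + y :> R by rewrite natrD natrM.
have E3 : (m + 3) * 'C((3 * q + c).+2, q.+1)%:R
        = (x + 2) * 'C((3 * q + c).+3, q.+2)%:R.
  by rewrite -m3 -x2 -!natrM mul_bin_diag.
have E2 : (m + 2) * 'C((3 * q + c).+1, q.+1)%:R
        = (2 * x + y + 1) * 'C((3 * q + c).+2, q.+1)%:R.
  by rewrite -m2 -n1 -!natrM mul_bin_down; congr ((_ * _)%:R); lia.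
have E1 : (m + 1) * 'C(3 * q + c, q.+1)%:R
        = (2 * x + y) * 'C((3 * q + c).+1, q.+1)%:R.
  by rewrite -m1 -n0 -!natrM mul_bin_down; congr ((_ * _)%:R); lia.
transitivity ((2 * x + y) * (2 * x + y + 1)
  * ((x + 2) * 'C((3 * q + c).+3, q.+2)%:R)).
  by ring.
rewrite -E3; transitivity ((2 * x + y) * (m + 3)
  * ((2 * x + y + 1) * 'C((3 * q + c).+2, q.+1)%:R)).
  by ring.
rewrite -E2; transitivity ((m + 2) * (m + 3)
  * ((2 * x + y) * 'C((3 * q + c).+1, q.+1)%:R)).
  by ring.
by rewrite -E1; ring.
Qed.

Lemma term_sq_le_succ c q : (c <= 2)%N -> (0 < 3 * q + c)%N ->
  term_sq c q <= term_sq c q.+1.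
Proof.
move=> c2 m0; rewrite /term_sq.
have x0 : 0 <= q%:R :> R by rewrite ler0n.
have y0 : 0 < 2 * q%:R + c%:R :> R by rewrite -natrM -natrD ltr0n; lia.
have key := term_ratio_le _ _ c2 x0; have E := bin_three_steps c q.
have -> : (3 * q.+1 + c = (3 * q + c).+3)%N by lia.
have mE : (3 * q + c)%:R = 3 * q%:R + c%:R :> R by rewrite natrD natrM.
have -> : (3 * q + c).+3%:R = 3 * q%:R + c%:R + 3 :> R.
  by rewrite -[in LHS]addn3 natrD mE.
have -> : (2 / 3) ^+ (3 * q + c).+3 = 8 / 27 * (2 / 3) ^+ (3 * q + c) :> R.
  by rewrite !(exprS _ (_ + c).+2) !(exprS _ (_ + c).+1) (exprS _ (_ + c)); field.
have p0 : 2 ^+ q != 0 :> R by rewrite expf_neq0.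
rewrite mE (exprS _ q); move: E key; cbv zeta.
move: y0 x0 p0; move: (2 ^+ q) (_ ^+ (3 * q + c)) => p t.
move: 'C(_, q.+2)%:R 'C(_, q.+1)%:R q%:R c%:R => C3 C x y y0 x0 p0 E key.
set G := 27 * (x + 2) * (2 * x + y) * (2 * x + y + 1) in key.
have G0 : 0 < G by rewrite /G !mulr_gt0//; lra.
(* Multiplying by [G ^ 2] makes [term_ratio_le] applicable; [m > 0] is what makes the factor
   [2 x + y] of [G] nonzero. *)
rewrite -(ler_pM2r (exprn_gt0 2 G0)).
have -> : (p^-1 * C * t) ^+ 2 * (3 * x + y) * G ^+ 2
        = (p^-1 * C * t) ^+ 2 * (G ^+ 2 * (3 * x + y)) by ring.
apply: (le_trans (ler_wpM2l (sqr_ge0 _) key)).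
rewrite le_eqVlt; apply/orP; left; apply/eqP.
transitivity ((p^-1 * t * 4) ^+ 2 * (3 * x + y + 3)
  * ((3 * x + y + 3) * (3 * x + y + 2) * (3 * x + y + 1) * C) ^+ 2); first by field.
by rewrite -E /G; field.
Qed.

Lemma term_sq_le c q : (c <= 2)%N -> (0 < 3 * q + c)%N -> term_sq c q <= 9 / pi.
Proof.
move=> c2 m0; pose v n := term_sq c (n + q).
have vS : nondecreasing_seq v.
  by apply/nondecreasing_seqP => n; rewrite /v addSn term_sq_le_succ//; lia.
have vl : v @ \oo --> 9 / (pi : R).
  rewrite (_ : v = fun n => term_sq c (1 * n + q)%N).
    by apply: cvg_affine => //; apply: term_sq_cvg; lia.
  by apply/funext => n; rewrite mul1n.
rewrite -(cvg_lim _ vl)//.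
by apply: (nondecreasing_cvgn_le vS (cvgP _ vl) 0%N).
Qed.

End threshold_term.

(** * Bounds and limit for [fm] *)

Section threshold.
Variable R : realType.

Lemma fmE m r : fm R m r = 2 ^- r * (binsum m r)%:R.
Proof. by rewrite /fm /binsum natr_sum. Qed.

Definition threshold m : R := 1 / 2 ^+ (m %/ 3) * 'C(m, r0 m)%:R.

Lemma divn3P m : exists p j, [/\ (j <= 2)%N, m = (3 * p + j)%N & (m %/ 3 = p)%N].
Proof.
exists (m %/ 3)%N, (m %% 3)%N; split=> //; last by lia.
by rewrite -ltnS ltn_pmod.
Qed.

Lemma fm_lt_threshold m : m \notin [:: 0; 1; 3; 6; 9; 12]%N ->
  fm R m (r0 m) < threshold m.
Proof.
have [p [j [j2 mE pE]]] := divn3P m; rewrite mE => mP.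
have := upper_gap_gt0 R j p j2 mP; rewrite /upper_gap -mE => gap.
rewrite fmE /threshold /r0 pE addn1 exprS invfM mul1r -mulrA mulrCA.
by rewrite ltr_pM2l ?invr_gt0 ?exprn_gt0//; lra.
Qed.

Lemma fm_gt_threshold m (k := (3 * r0 m - m)%N) :
  threshold m * (1 - (k + 2)%:R / (2 * (r0 m + 1))%:R) < fm R m (r0 m).
Proof.
have [p [j [j2 mE pE]]] := divn3P m.
have := lower_gap_gt0 R j p j2; rewrite /lower_gap -mE => gap.
have kE : (k = 3 - j)%N by rewrite /k /r0 pE mE; lia.
rewrite fmE /threshold /r0 pE !addn1 kE exprS invfM mul1r -mulrA -[ltRHS]mulrA.
rewrite [ltRHS]mulrCA ltr_pM2l ?invr_gt0 ?exprn_gt0//.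
have := bin_succ_ratio R m p.+1.
have p0 : 0 <= p%:R :> R by rewrite ler0n.
have -> : (3 - j + 2)%:R = 5 - j%:R :> R.
  by rewrite (_ : 3 - j + 2 = 5 - j)%N ?natrB//; lia.
have -> : m%:R = 3 * p%:R + j%:R :> R by rewrite mE natrD natrM.
rewrite natrM -[p.+2]addn2 -[p.+1]addn1 !(natrD _ p) => E.
(* The stated lower bound is half the next binomial, up to [2 ^- p]: with [k = 3 - j], twice the
   bracket is [(m - p - 1) / (p + 2)]. *)
have -> : 'C(m, p + 1)%:R * (1 - (5 - j%:R) / (2 * (p%:R + 2)))
   = 2^-1 * 'C(m, p + 2)%:R :> R.
  apply: (@mulfI _ (p%:R + 2)); first by rewrite gt_eqF//; lra.
  rewrite [RHS]mulrCA E; field.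
  by rewrite gt_eqF//; lra.
rewrite ltr_pM2l ?invr_gt0//; move: gap; rewrite addn1 addn2; lra.
Qed.

Lemma threshold_sqrt m :
  threshold m * Num.sqrt m%:R * (2 / 3) ^+ m
  = Num.sqrt (term_sq R (m %% 3) (m %/ 3)).
Proof.
rewrite /term_sq (_ : 3 * (m %/ 3) + m %% 3 = m)%N; last by lia.
rewrite sqrtrM ?sqr_ge0// sqrtr_sqr ger0_norm; last first.
  by rewrite !mulr_ge0// ?invr_ge0 exprn_ge0.
by rewrite /threshold /r0 addn1 mul1r mulrAC.
Qed.

Lemma sqrt_9_pi : Num.sqrt (9 / pi) = 3 / Num.sqrt pi :> R.
Proof.
rewrite sqrtrM// sqrtrV ?pi_ge0//; congr (_ / _).
by rewrite (_ : 9 = 3 ^+ 2) ?sqrtr_sqr ?ger0_norm//; ring.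
Qed.

Lemma threshold_le m : (0 < m)%N ->
  threshold m <= 3 / Num.sqrt (pi * m%:R) * (3 / 2) ^+ m.
Proof.
move=> m0; have s0 : 0 < Num.sqrt m%:R :> R by rewrite sqrtr_gt0 ltr0n.
have e0 : 0 < (2 / 3) ^+ m :> R by rewrite exprn_gt0.
rewrite -(ler_pM2r s0) -(ler_pM2r e0) threshold_sqrt.
have -> : 3 / Num.sqrt (pi * m%:R) * (3 / 2) ^+ m * Num.sqrt m%:R * (2 / 3) ^+ m
   = 3 / Num.sqrt pi :> R.
  have -> : (3 / 2) ^+ m = ((2 / 3) ^+ m)^-1 :> R by rewrite -exprVn invf_div.
  have q0 : 0 < Num.sqrt pi :> R by rewrite sqrtr_gt0 pi_gt0.
  rewrite sqrtrM ?pi_ge0//.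
  move: s0 e0 q0; move: (Num.sqrt _) (Num.sqrt _) (_ ^+ m) => a b c a0 c0 b0.
  by field; rewrite !gt_eqF.
rewrite -sqrt_9_pi ler_wsqrtr// term_sq_le//; first by rewrite -ltnS ltn_pmod.
by lia.
Qed.

Lemma cvg_mod3 (u : nat -> nat -> R) (l : R) :
    (forall j, (j <= 2)%N -> u j @ \oo --> l) ->
  (fun m => u (m %% 3)%N (m %/ 3)%N) @ \oo --> l.
Proof.
move=> ul; apply/cvgrPdist_lt => e e0.
have h j : (j <= 2)%N ->
    exists N, forall q, (N <= q)%N -> `|l - u j q| < e.
  by move=> /ul/cvgrPdist_lt/(_ e e0)[N _ NP]; exists N => q /NP.
have [N0 h0] := h 0%N isT; have [N1 h1] := h 1%N isT; have [N2 h2] := h 2%N isT.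
(* From this index on, [m %/ 3] exceeds the thresholds of all three residues. *)
exists (3 * (N0 + N1 + N2))%N => // m /= Nm.
have := ltn_pmod m (isT : 0 < 3)%N.
by case: (m %% 3)%N => [|[|[|//]]] _; [apply: h0|apply: h1|apply: h2]; lia.
Qed.

Lemma threshold_cvg :
  (fun m => threshold m * Num.sqrt m%:R * (2 / 3) ^+ m) @ \oo
    --> 3 / Num.sqrt (pi : R).
Proof.
rewrite -sqrt_9_pi (funext threshold_sqrt).
apply: continuous_cvg; first exact: sqrt_continuous.
by apply: cvg_mod3 => j j2; apply: term_sq_cvg; lia.
Qed.

Lemma fm_cvg :
  (fun m => fm R m (r0 m) * Num.sqrt m%:R * (2 / 3) ^+ m) @ \oo
    --> 3 / Num.sqrt (pi : R).
Proof.
(* The constant [8] works since [k + 2 <= 5] and [m + 1 <= 3 * r0 m] give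
   [(k + 2) * (m + 1) <= 16 * (r0 m + 1)]. *)
apply: (@squeeze_cvgr _ _ _ _
  (fun m => threshold m * Num.sqrt m%:R * (2 / 3) ^+ m * (1 - 8 * m.+1%:R^-1))
  (fun m => threshold m * Num.sqrt m%:R * (2 / 3) ^+ m)).
- near=> m.
  have m13 : (13 <= m)%N by near: m; exists 13%N.
  have mP : m \notin [:: 0; 1; 3; 6; 9; 12]%N by rewrite !inE; lia.
  have e0 : 0 < (2 / 3) ^+ m :> R by rewrite exprn_gt0.
  have s0 : 0 <= Num.sqrt m%:R :> R by rewrite sqrtr_ge0.
  apply/andP; split; last first.
    by rewrite (ler_wpM2r (ltW e0))// ler_wpM2r// (ltW (fm_lt_threshold _ mP)).
  rewrite mulrAC ler_wpM2r ?(ltW e0)// mulrAC ler_wpM2r//.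
  apply: le_trans (ltW (fm_gt_threshold m)).
  rewrite ler_wpM2l ?mulr_ge0 ?divr_ge0 ?exprn_ge0// lerD2l lerN2.
  rewrite ler_pdivrMr ?ltr0n ?muln_gt0 ?addn1// mulrAC ler_pdivlMr ?ltr0n//.
  rewrite -!natrM ler_nat /r0.
  have : (3 * (m %/ 3 + 1) - m <= 3)%N by lia.
  by nia.
- have h : (fun m => threshold m * Num.sqrt m%:R * (2 / 3) ^+ m * (1 - 8 * m.+1%:R^-1))
      @ \oo --> 3 / Num.sqrt (pi : R) * (1 - 8 * 0).
    apply: cvgM; first exact: threshold_cvg.
    apply: cvgB; first exact: cvg_cst.
    by apply: cvgM; [exact: cvg_cst|exact: cvg_harmonic].
  by rewrite mulr0 subr0 mulr1 in h.
- exact: threshold_cvg.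
Unshelve. all: end_near. Qed.

End threshold.

Theorem theorem2 (R : realType) :
  (forall m : nat, m \notin [:: 0; 1; 3; 6; 9; 12]%N ->
    let k := (3 * r0 m - m)%N in
    [/\ k \in [:: 1; 2; 3]%N,
        1 / 2 ^+ (m %/ 3) * (1 - (k + 2)%:R / (2 * (r0 m + 1))%:R)
          * 'C(m, r0 m)%:R < fm R m (r0 m),
        fm R m (r0 m) < 1 / 2 ^+ (m %/ 3) * 'C(m, r0 m)%:R
      & fm R m (r0 m) < 3 / Num.sqrt (pi * m%:R) * (3 / 2) ^+ m]) /\
  (fun m : nat => fm R m (r0 m) * Num.sqrt m%:R * (2 / 3) ^+ m) @ \oo
    --> 3 / Num.sqrt (pi : R).
Proof.
split; last exact: fm_cvg.
move=> m mP k; split.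
- by rewrite /k /r0 !inE; lia.
- by rewrite mulrAC; exact: fm_gt_threshold.
- exact: fm_lt_threshold.
- apply: lt_le_trans (fm_lt_threshold R m mP) (threshold_le R m _).
  by move: mP; rewrite !inE; lia.
Qed.
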